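(* For a cycle set $K$, the following are equivalent: (1) $K$ is isomorphic to $A(G)$ for some digraph $G$, where $A$ is the attractor functor; (2) the unit map $\eta_K \colon K \to A|K|$ of the adjunction $|\mathord{-}| \dashv A$ is an isomorphism; (3) $K$ is isomorphic to a coproduct of representables $$K \cong \coprod_{k \geq 1} \ \coprod_{[x] \in \mathrm{Orb}_{\mathrm{nd}} K_k} \widehat{C}_k$$ indexed by the non-degenerate orbits of $K$; (4) $K$ satisfies Properties A and B.
   Context: A digraph is a set $V$ of vertices with a set $E \subseteq V \times V$ of edges (loops allowed); a graph map is a function on vertices carrying edges to edges; these form the category $\mathsf{DiGraph}$. For $n \geq 1$, $C_n$ is the directed $n$-cycle: vertices $\{0,\dots,n-1\}$, edges $i \to i+1 \bmod n$ (so $C_1$ is one looped vertex). $\mathbf{C}_\bullet$ is the full subcategory of $\mathsf{DiGraph}$ on the $C_n$, $n\ge 1$. For $n \mid m$, $\mu_{m,n}\colon C_m \to C_n$ is $k \mapsto k \bmod n$; for $i \in \mathbb{Z}/n$, $\rho_{n,i}\colon C_n \to C_n$ is $k \mapsto k+i \bmod n$. A cycle set is a functor $K\colon \mathbf{C}_\bullet^{\mathrm{op}} \to \mathsf{Set}$; these and natural transformations form the category $\mathsf{cySet}$. Write $K_n := K(C_n)$ (its elements are the $n$-cycles of $K$) and $x\varphi := K(\varphi)(x) \in K_m$ for $x \in K_n$, $\varphi\colon C_m \to C_n$. The group $\mathbb{Z}/n$ acts on $K_n$ by $i\cdot x := x\rho_{n,i}$. A cycle $x \in K_m$ is non-degenerate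 if the only solution of $x = y\mu_{m,n}$ (with $n \mid m$, $y \in K_n$) is $n=m$, $y=x$. Non-degeneracy is constant on orbits; $\mathrm{Orb}_{\mathrm{nd}} K_k$ denotes the set of non-degenerate elements of $K_k$ modulo the relation of being in the same $\mathbb{Z}/k$-orbit. $\widehat{C}_k := \mathbf{C}_\bullet(-,C_k)$ is the cycle set represented by $C_k$. The attractor functor $A\colon \mathsf{DiGraph} \to \mathsf{cySet}$ sends $G$ to the cycle set with $A(G)_n := \{\text{graph maps } C_n \to G\}$, with $\mathbf{C}_\bullet$ acting by precomposition, and acts on graph maps by postcomposition. The digraph realization $|\mathord{-}|\colon \mathsf{cySet} \to \mathsf{DiGraph}$ is the left Kan extension of the inclusion $\mathbf{C}_\bullet \hookrightarrow \mathsf{DiGraph}$ along the Yoneda embedding $\mathbf{C}_\bullet \hookrightarrow \mathsf{cySet}$, i.e. $|K|$ is the colimit in $\mathsf{DiGraph}$ of $C_n$ over the category of pairs $(n, x\in K_n)$; it is left adjoint to $A$. The unit is $(\eta_K)_n(x) := $ the colimit coprojection $C_n \to |K|$ indexed by $(n,x)$. Property A: for all $m,n\ge 1$ with $n \mid m$, the function $K(\mu_{m,n})\colon K_n \to K_m$ is injective. Property B: for any $x \in K_n$, if $x\rho_{n,k} = x$ for some $k$ dividing $n$, then $x = y\mu_{n,k}$ for some $y \in K_k$. *)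

(* Defs.v *)
From HB Require Import structures.
From Stdlib Require Import Relation_Operators.
From mathcomp Require Import all_boot boolp.

Set Implicit Arguments.
Unset Strict Implicit.
Unset Printing Implicit Defensive.

(* Quotient of an arbitrary type by the equivalence relation generated by R. *)
Section Quotient.
Variables (T : Type) (R : T -> T -> Prop).

Definition gen_eqv (x y : {classic T}) : bool :=
  `[< clos_refl_sym_trans T R x y >].

Lemma gen_eqv_refl : reflexive gen_eqv.
Proof. by move=> x; apply/asboolP; apply: rst_refl. Qed.

Lemma gen_eqv_sym : symmetric gen_eqv.
Proof. by move=> x y; apply/asboolP/asboolP; apply: rst_sym. Qed.

Lemma gen_eqv_trans : transitive gen_eqv.
Proof. by move=> y x z /asboolP xy /asboolP yz; apply/asboolP; apply: rst_trans yz. Qed.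

Canonical gen_eqv_equiv :=
  EquivRel gen_eqv gen_eqv_refl gen_eqv_sym gen_eqv_trans.

Definition quot : Type := {eq_quot gen_eqv}%qT.

Definition qclass (x : T) : quot := (\pi_{eq_quot gen_eqv} (x : {classic T}))%qT.

Lemma qclassE x y : qclass x = qclass y <-> clos_refl_sym_trans T R x y.
Proof.
split=> [/eqmodP/asboolP //|xy].
by apply/eqmodP/asboolP.
Qed.

Lemma qclass_surj (q : quot) : exists x, q = qclass x.
Proof. by exists (repr q : {classic T}); rewrite /qclass reprK. Qed.

End Quotient.

Lemma qclass_eqP (T : Type) (R : T -> T -> Prop) :
    (forall x, R x x) -> (forall x y, R x y -> R y x) ->
    (forall x y z, R x y -> R y z -> R x z) ->
  forall x y, qclass R x = qclass R y <-> R x y.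
Proof.
move=> Rr Rs Rt x y; rewrite qclassE; split=> [|xy]; last exact: rst_step.
by elim=> // [a b _|a b c _ ab _]; [exact: Rs | exact: Rt].
Qed.

Record digraph := Digraph {
  vertex :> Type;
  edge : vertex -> vertex -> Prop }.

Record digraphMap (G H : digraph) := DigraphMap {
  map_fun :> G -> H;
  map_edge : forall x y, edge x y -> edge (map_fun x) (map_fun y) }.

Lemma digraphMap_eq G H (f g : digraphMap G H) : (forall x, f x = g x) -> f = g.
Proof.
case: f g => [f fE] [g gE] /= /funext fg; case: _ / fg in gE *.
by congr DigraphMap; apply: Prop_irrelevance.
Qed.

Definition idMap G : digraphMap G G := @DigraphMap G G id (fun _ _ => id).

Definition compMap G H L (g : digraphMap H L) (f : digraphMap G H) :
    digraphMap G L :=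
  @DigraphMap G L (g \o f) (fun x y xy => map_edge g (map_edge f xy)).

Lemma compMap_id G H (f : digraphMap G H) : compMap f (idMap G) = f.
Proof. exact: digraphMap_eq. Qed.

Lemma compMapA G H L M (h : digraphMap L M) (g : digraphMap H L)
    (f : digraphMap G H) : compMap h (compMap g f) = compMap (compMap h g) f.
Proof. exact: digraphMap_eq. Qed.

(* The positive integers, which index the objects of the category C_bullet. *)
Record posNat := PosNat { posNat_val :> nat; posNat_gt0 : 0 < posNat_val }.

Definition dicycle (n : posNat) : digraph :=
  @Digraph 'I_n (fun i j => j = i.+1 %% n :> nat).

Lemma mu_edge (m n : posNat) (nm : n %| m) (x y : dicycle m) :
  edge x y ->
  edge (Ordinal (ltn_pmod x (posNat_gt0 n)) : dicycle n)
       (Ordinal (ltn_pmod y (posNat_gt0 n)) : dicycle n).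
Proof. by move=> /= ->; rewrite modn_dvdm // -addn1 -modnDml addn1. Qed.

Definition mu (m n : posNat) (nm : n %| m) : digraphMap (dicycle m) (dicycle n) :=
  DigraphMap (mu_edge nm).

Lemma rho_edge (n : posNat) (i : nat) (x y : dicycle n) :
  edge x y ->
  edge (Ordinal (ltn_pmod (x + i) (posNat_gt0 n)) : dicycle n)
       (Ordinal (ltn_pmod (y + i) (posNat_gt0 n)) : dicycle n).
Proof. by move=> /= ->; rewrite modnDml -[in RHS]addn1 modnDml addn1. Qed.

(* The residue i mod n is given by any natural number representing it, so that
   [rho n n] is the identity. *)
Definition rho (n : posNat) (i : nat) : digraphMap (dicycle n) (dicycle n) :=
  DigraphMap (@rho_edge n i).

(* Since C_bullet is a full subcategory of digraphs, its morphisms are all the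
   graph maps between directed cycles. *)
Record cycleSet := CycleSet {
  cells :> posNat -> Type;
  act : forall m n, digraphMap (dicycle m) (dicycle n) -> cells n -> cells m;
  act_id : forall n (x : cells n), act (idMap (dicycle n)) x = x;
  act_comp : forall l m n (psi : digraphMap (dicycle l) (dicycle m))
      (phi : digraphMap (dicycle m) (dicycle n)) (x : cells n),
    act (compMap phi psi) x = act psi (act phi x) }.

Record cycleSetMap (K L : cycleSet) := CycleSetMap {
  component :> forall n, K n -> L n;
  natural : forall m n (phi : digraphMap (dicycle m) (dicycle n)) (x : K n),
    component (act phi x) = act phi (component x) }.

Definition isIso (K L : cycleSet) (f : cycleSetMap K L) : Prop :=
  exists g : cycleSetMap L K,
    (forall n (x : K n), g n (f n x) = x) /\ (forall n (y : L n), f n (g n y) = y).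

Definition isomorphic (K L : cycleSet) : Prop :=
  exists f : cycleSetMap K L, isIso f.

Definition representable (k : posNat) : cycleSet :=
  @CycleSet (fun n => digraphMap (dicycle n) (dicycle k))
    (fun m n phi x => compMap x phi)
    (fun n x => compMap_id x)
    (fun l m n psi phi x => compMapA x phi psi).

Section Coproduct.
Variables (I : Type) (F : I -> cycleSet).

Definition coprod_act m n (phi : digraphMap (dicycle m) (dicycle n))
    (x : {i : I & F i n}) : {i : I & F i m} :=
  existT (fun i => F i m) (projT1 x) (act phi (projT2 x)).

Lemma coprod_act_id n (x : {i : I & F i n}) :
  coprod_act (idMap (dicycle n)) x = x.
Proof. by case: x => i x; rewrite /coprod_act /= act_id. Qed.

Lemma coprod_act_comp l m n (psi : digraphMap (dicycle l) (dicycle m))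
    (phi : digraphMap (dicycle m) (dicycle n)) (x : {i : I & F i n}) :
  coprod_act (compMap phi psi) x = coprod_act psi (coprod_act phi x).
Proof. by rewrite /coprod_act /= act_comp. Qed.

(* Coproducts of presheaves are computed objectwise. *)
Definition coprod : cycleSet := CycleSet coprod_act_id coprod_act_comp.

Definition coprod_inj_fun i n (x : F i n) : coprod n :=
  existT (fun j => F j n) i x.

Definition coprod_inj i : cycleSetMap (F i) coprod :=
  @CycleSetMap (F i) coprod (@coprod_inj_fun i) (fun _ _ _ _ => erefl).

Lemma coprod_universal (L : cycleSet) (f : forall i, cycleSetMap (F i) L) :
  exists g : cycleSetMap coprod L,
    (forall i n (x : F i n), g n (coprod_inj i n x) = f i n x) /\
    (forall h : cycleSetMap coprod L,
      (forall i n (x : F i n), h n (coprod_inj i n x) = f i n x) ->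
      forall n y, h n y = g n y).
Proof.
pose g n (y : coprod n) : L n := f (projT1 y) n (projT2 y).
have gN m n phi (y : coprod n) : g m (act phi y) = act phi (g n y).
  exact: natural.
by exists (CycleSetMap gN); split=> // h hE n [i x]; apply: hE.
Qed.

End Coproduct.

Definition attractor (G : digraph) : cycleSet :=
  @CycleSet (fun n => digraphMap (dicycle n) G)
    (fun m n phi x => compMap x phi)
    (fun n x => compMap_id x)
    (fun l m n psi phi x => compMapA x phi psi).

Definition attractor_map G H (f : digraphMap G H) :
    cycleSetMap (attractor G) (attractor H) :=
  @CycleSetMap (attractor G) (attractor H) (fun n x => compMap f x)
    (fun m n phi x => compMapA f x phi).

Section Realization.
Variable K : cycleSet.

(* The disjoint union of the vertex sets of the diagram of directed cycles
   indexed by the category of elements of K. *)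
Definition preVertex : Type := {n : posNat & (K n * dicycle n)%type}.

Definition preV n (x : K n) (i : dicycle n) : preVertex :=
  existT (fun n => (K n * dicycle n)%type) n (x, i).

Inductive glue : preVertex -> preVertex -> Prop :=
  Glue m n (phi : digraphMap (dicycle m) (dicycle n)) (x : K n) (i : dicycle m) :
    glue (preV (act phi x) i) (preV x (phi i)).

Definition realV : Type := quot glue.

Inductive realE : realV -> realV -> Prop :=
  RealE n (x : K n) (i j : dicycle n) : edge i j ->
    realE (qclass glue (preV x i)) (qclass glue (preV x j)).

Definition realization : digraph := Digraph realE.

Definition coproj n (x : K n) : digraphMap (dicycle n) realization :=
  @DigraphMap (dicycle n) realization (fun i => qclass glue (preV x i))
    (fun i j ij => RealE x ij).

Lemma coproj_cocone m n (phi : digraphMap (dicycle m) (dicycle n)) (x : K n) :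
  coproj (act phi x) = compMap (coproj x) phi.
Proof.
by apply: digraphMap_eq => i; apply/qclassE; apply: rst_step; apply: Glue.
Qed.

Lemma realization_colimit (G : digraph)
    (c : forall n, K n -> digraphMap (dicycle n) G) :
    (forall m n (phi : digraphMap (dicycle m) (dicycle n)) (x : K n),
      c m (act phi x) = compMap (c n x) phi) ->
  exists! f : digraphMap realization G,
    forall n (x : K n), compMap f (coproj x) = c n x.
Proof.
move=> cC; pose c0 (p : preVertex) : G := c _ (projT2 p).1 (projT2 p).2.
have c0E p q : clos_refl_sym_trans _ glue p q -> c0 p = c0 q.
  elim=> [_ _ [m n phi x i] | // | _ _ _ -> // | p1 p2 p3 _ -> _ -> //].
  by rewrite /c0 /= cC.
pose f (v : realV) : G := c0 (repr v : {classic preVertex}).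
have fE p : f (qclass glue p) = c0 p.
  by apply/c0E/qclassE; rewrite /qclass reprK.
have fM x y : realE x y -> edge (f x) (f y).
  by case=> n z i j ij; rewrite !fE; apply: map_edge.
exists (DigraphMap (fM : forall x y : realization, edge x y -> _)); split.
  by move=> n x; apply: digraphMap_eq => i; rewrite /= fE.
move=> g gE; apply: digraphMap_eq => v /=.
have [[n [x i]] ->] := qclass_surj v.
by rewrite fE /c0 /= -gE.
Qed.

Definition eta : cycleSetMap K (attractor realization) :=
  @CycleSetMap K (attractor realization) coproj coproj_cocone.

(* The adjunction: eta is a universal arrow from K to the attractor functor. *)
Lemma eta_universal (G : digraph) (f : cycleSetMap K (attractor G)) :
  exists! g : digraphMap realization G,
    forall n (x : K n), attractor_map g n (eta n x) = f n x.
Proof. by apply: realization_colimit => m n phi x; exact: (natural f). Qed.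

End Realization.

(* Equality in the total space of K expresses "n = m and y = x". *)
Definition nondegenerate (K : cycleSet) (m : posNat) (x : K m) : Prop :=
  forall (n : posNat) (nm : n %| m) (y : K n),
    x = act (mu nm) y -> existT K n y = existT K m x.

Definition sameOrbit (K : cycleSet) (k : posNat) (x y : K k) : Prop :=
  exists i : 'I_k, y = act (rho k i) x.

Lemma sameOrbit_refl (K : cycleSet) (k : posNat) (x : K k) : sameOrbit x x.
Proof.
exists (Ordinal (posNat_gt0 k)); rewrite -[LHS]act_id; congr act.
by apply: digraphMap_eq => i; apply: val_inj; rewrite /= addn0 modn_small.
Qed.

Lemma sameOrbit_sym (K : cycleSet) (k : posNat) (x y : K k) :
  sameOrbit x y -> sameOrbit y x.
Proof.
move=> [i ->]; exists (Ordinal (ltn_pmod (k - i) (posNat_gt0 k))).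
rewrite -act_comp -[LHS]act_id; congr act.
apply: digraphMap_eq => j; apply: val_inj => /=.
by rewrite modnDml addnAC modnDmr -addnA subnKC 1?ltnW // modnDr modn_small.
Qed.

Lemma sameOrbit_trans (K : cycleSet) (k : posNat) (x y z : K k) :
  sameOrbit x y -> sameOrbit y z -> sameOrbit x z.
Proof.
move=> [i ->] [j ->]; exists (Ordinal (ltn_pmod (i + j) (posNat_gt0 k))).
rewrite -act_comp; congr act; apply: digraphMap_eq => l; apply: val_inj => /=.
by rewrite modnDml modnDmr addnA addnAC.
Qed.

Definition orbNd (K : cycleSet) (k : posNat) : Type :=
  quot (fun x y : {x : K k | nondegenerate x} =>
          sameOrbit (sval x) (sval y)).

Lemma orbNdP (K : cycleSet) (k : posNat) (x y : {x : K k | nondegenerate x}) :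
  qclass _ x = qclass _ y :> orbNd K k <-> sameOrbit (sval x) (sval y).
Proof.
apply: (@qclass_eqP _ (fun x y => sameOrbit (sval x) (sval y))).
- by move=> *; apply: sameOrbit_refl.
- by move=> *; apply: sameOrbit_sym.
- by move=> a b c; apply: sameOrbit_trans.
Qed.

Definition propertyA (K : cycleSet) : Prop :=
  forall (m n : posNat) (nm : n %| m),
    injective (act (mu nm) : K n -> K m).

Definition propertyB (K : cycleSet) : Prop :=
  forall (n : posNat) (x : K n) (k : posNat) (kn : k %| n),
    act (rho n k) x = x -> exists y : K k, x = act (mu kn) y.

(* Main.v *)
(** Every map [C_m -> C_n] is a rotation after the projection [mu], and exists
only if [n %| m]. Under A and B every cycle is a [mu]-pullback of a
non-degenerate one, unique by a gcd argument: if [x] is pulled back from [C_n]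
and from [C_n'], it is fixed by the rotations by [n] and [n'], hence by
[gcd n n'], so B and then A push the descent down to [C_(gcd n n')]. This yields
the coproduct decomposition, with freeness of the rotation action on
non-degenerate cycles coming from B. Since directed cycles are connected, a
coproduct of representables is the attractor of the disjoint union [D] of the
corresponding directed cycles, and its realization is [D] itself. *)

Require Import Defs.
From mathcomp Require Import all_boot boolp.

Set Implicit Arguments.
Unset Strict Implicit.
Unset Printing Implicit Defensive.

(** * Equalities in dependent sums, and isomorphisms of cycle sets *)

Lemma posNat_inj (m n : posNat) : m = n :> nat -> m = n.
Proof.
by case: m n => [m m0] [n n0] /= mn; subst n; congr PosNat; apply: bool_irrelevance.
Qed.

Lemma existT_inj (I : Type) (F : I -> Type) (i : I) (x y : F i) :
  existT F i x = existT F i y -> x = y.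
Proof.
move=> xy; have := projT2_eq xy.
by rewrite (Prop_irrelevance (projT1_eq xy) erefl).
Qed.

Lemma surjective_inverse (S T : Type) (f : S -> T) :
  injective f -> (forall y, exists x, y = f x) -> {g | cancel f g & cancel g f}.
Proof.
move=> f_inj f_surj; have fK y := svalP (cid (f_surj y)).
exists (fun y => sval (cid (f_surj y))) => [x|y]; last by rewrite -fK.
by apply: f_inj; rewrite -fK.
Qed.

(** The pointwise inverse is automatically natural: naturality can be tested after applying the
    injective [f]. *)
Lemma bij_isIso (K L : cycleSet) (f : cycleSetMap K L) :
  (forall n, injective (f n)) -> (forall n y, exists x, y = f n x) -> isIso f.
Proof.
move=> f_inj f_surj.
pose g n := s2val (surjective_inverse (f_inj n) (f_surj n)).
have fK n : cancel (f n) (g n) := s2valP (surjective_inverse (f_inj n) (f_surj n)).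
have gK n : cancel (g n) (f n) := s2valP' (surjective_inverse (f_inj n) (f_surj n)).
have gN m n (phi : digraphMap (dicycle m) (dicycle n)) y :
  g m (act phi y) = act phi (g n y).
  by apply: (f_inj m); rewrite natural !gK.
by exists (CycleSetMap gN); split.
Qed.

Lemma isomorphic_sym (K L : cycleSet) : isomorphic K L -> isomorphic L K.
Proof. by move=> [f [g [fK gK]]]; exists g, f. Qed.

Lemma isomorphic_trans (K L M : cycleSet) :
  isomorphic K L -> isomorphic L M -> isomorphic K M.
Proof.
move=> [f [f' [fK f'K]]] [g [g' [gK g'K]]].
have hN m n (phi : digraphMap (dicycle m) (dicycle n)) x :
  g m (f m (act phi x)) = act phi (g n (f n x)) by rewrite !natural.
have hN' m n (phi : digraphMap (dicycle m) (dicycle n)) x :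
  f' m (g' m (act phi x)) = act phi (f' n (g' n x)) by rewrite !natural.
exists (@CycleSetMap K M (fun n x => g n (f n x)) hN).
exists (@CycleSetMap M K (fun n x => f' n (g' n x)) hN').
by split=> n x /=; rewrite ?gK ?fK ?f'K ?g'K.
Qed.

Lemma compMapE (G H L : digraph) (g : digraphMap H L) (f : digraphMap G H) v :
  compMap g f v = g (f v).
Proof. by []. Qed.

(** * Graph maps between directed cycles *)

Lemma modn_posNat_lt (n : posNat) (a : nat) : a %% n < n.
Proof. exact/ltn_pmod/posNat_gt0. Qed.

(** Naming vertices by arbitrary naturals allows induction along the cycle with no special case at
    the wrap-around edge. *)
Definition cyc (n : posNat) (a : nat) : dicycle n := Ordinal (modn_posNat_lt n a).

Lemma cyc_val (n : posNat) (i : dicycle n) : cyc n (i : 'I_n) = i.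
Proof. by apply: val_inj; rewrite /= modn_small. Qed.

Lemma eq_cyc (n : posNat) (a b : nat) : a = b %[mod n] -> cyc n a = cyc n b.
Proof. by move=> ab; apply: val_inj. Qed.

Lemma cyc_edge (n : posNat) (a : nat) : edge (cyc n a) (cyc n a.+1).
Proof. by rewrite /= -addn1 -modnDml addn1. Qed.

Lemma edge_cyc (n : posNat) (i j : dicycle n) :
  edge i j -> j = cyc n (i : 'I_n).+1.
Proof. by move=> /= ij; apply: val_inj. Qed.

Lemma mu_cyc (m n : posNat) (nm : n %| m) a : mu nm (cyc m a) = cyc n a.
Proof. by apply: val_inj; rewrite /= modn_dvdm. Qed.

Lemma rho_cyc (n : posNat) i a : rho n i (cyc n a) = cyc n (a + i).
Proof. by apply: val_inj; rewrite /= modnDml. Qed.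

Lemma cycle_map_eq (n : posNat) (G : digraph) (f g : digraphMap (dicycle n) G) :
  (forall a, f (cyc n a) = g (cyc n a)) -> f = g.
Proof. by move=> fg; apply: digraphMap_eq => i; rewrite -(cyc_val i). Qed.

(** Every vertex of a directed cycle has exactly one out-neighbour, so the image of 0 determines the
    map. *)
Lemma cycle_map_cyc (m n : posNat) (phi : digraphMap (dicycle m) (dicycle n)) a :
  phi (cyc m a) = cyc n (a + (phi (cyc m 0) : 'I_n)).
Proof.
elim: a => [|a IHa]; first by rewrite cyc_val.
have /edge_cyc := map_edge phi (cyc_edge m a); rewrite IHa => ->.
by apply: eq_cyc; rewrite /= addSn -addn1 modnDml addn1.
Qed.

(** A walk of [m] steps is closed in the source, so its image is closed in the target. *)
Lemma cycle_map_dvdn (m n : posNat) (phi : digraphMap (dicycle m) (dicycle n)) :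
  n %| m.
Proof.
have: phi (cyc m m) = phi (cyc m 0) by congr (phi _); apply: eq_cyc; rewrite modnn mod0n.
rewrite [in LHS]cycle_map_cyc [in RHS]cycle_map_cyc => /(congr1 val) /= /eqP.
by rewrite eqn_modDr mod0n.
Qed.

Lemma cycle_mapE (m n : posNat) (phi : digraphMap (dicycle m) (dicycle n))
    (nm : n %| m) :
  phi = compMap (rho n (phi (cyc m 0) : 'I_n)) (mu nm).
Proof.
by apply: cycle_map_eq => a; rewrite cycle_map_cyc compMapE mu_cyc rho_cyc.
Qed.

Lemma mu_id (n : posNat) (nn : n %| n) : mu nn = idMap _.
Proof. by apply: cycle_map_eq => a; rewrite mu_cyc. Qed.

Lemma mu_comp (l m n : posNat) (ml : m %| l) (nm : n %| m) (nl : n %| l) :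
  compMap (mu nm) (mu ml) = mu nl.
Proof. by apply: cycle_map_eq => a; rewrite !compMapE !mu_cyc. Qed.

Lemma cycle_periodic (T : Type) (n : posNat) (f : dicycle n -> T) (k : nat) :
  (forall i, f (rho n k i) = f i) ->
  forall a, f (cyc n (a %% k)) = f (cyc n a).
Proof.
move=> fk a; rewrite [in RHS](divn_eq a k) addnC.
elim: (a %/ k) => [|q IHq]; first by rewrite addn0.
by rewrite mulSn [k + _]addnC addnA -rho_cyc fk.
Qed.

(** * Rotations, non-degenerate cycles and their uniqueness *)

Section RotationAction.
Variable K : cycleSet.

Lemma act_muM (l m n : posNat) (ml : m %| l) (nm : n %| m) (nl : n %| l) (x : K n) :
  act (mu ml) (act (mu nm) x) = act (mu nl) x.
Proof. by rewrite -act_comp (mu_comp _ _ nl). Qed.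

Lemma act_mu_id (n : posNat) (nn : n %| n) (x : K n) : act (mu nn) x = x.
Proof. by rewrite mu_id act_id. Qed.

Lemma act_rho0 (n : posNat) (x : K n) i : n %| i -> act (rho n i) x = x.
Proof.
move=> ni; rewrite -[RHS]act_id; congr act.
apply: cycle_map_eq => a; rewrite rho_cyc.
by apply: eq_cyc; rewrite -modnDmr (eqP ni) addn0.
Qed.

Lemma act_rhoD (n : posNat) (x : K n) i j :
  act (rho n i) (act (rho n j) x) = act (rho n (i + j)) x.
Proof.
rewrite -act_comp; congr act; apply: cycle_map_eq => a.
by rewrite !compMapE !rho_cyc addnA.
Qed.

Lemma act_rho_mu (m n : posNat) (nm : n %| m) (x : K n) i :
  act (rho m i) (act (mu nm) x) = act (mu nm) (act (rho n i) x).
Proof.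
rewrite -!act_comp; congr act; apply: cycle_map_eq => a.
by rewrite !compMapE rho_cyc !mu_cyc rho_cyc.
Qed.

Lemma act_rho_inj (n : posNat) i : injective (act (rho n i) : K n -> K n).
Proof.
(* [n * i - i] represents [-i] modulo [n]; it is a true difference because [n] is positive. *)
move=> x y /(congr1 (act (rho n (n * i - i)))).
by rewrite !act_rhoD subnK ?leq_pmull ?posNat_gt0 // !act_rho0 ?dvdn_mulr.
Qed.

Lemma act_rhoM (n : posNat) (x : K n) i q :
  act (rho n i) x = x -> act (rho n (q * i)) x = x.
Proof.
by move=> xi; elim: q => [|q IHq]; [rewrite act_rho0 | rewrite mulSn -act_rhoD IHq].
Qed.

Lemma act_rho_gcd (n : posNat) (x : K n) i j : 0 < i ->
  act (rho n i) x = x -> act (rho n j) x = x ->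
  act (rho n (gcdn i j)) x = x.
Proof.
move=> i_gt0 xi xj; have [ki kj e _] := egcdnP j i_gt0.
(* Bézout over the naturals reads [ki * i = kj * j + gcdn i j], so a further rotation by [kj * j]
   turns the gcd into a multiple of [i]. *)
apply: (@act_rho_inj n (kj * j)).
by rewrite act_rhoD -e !act_rhoM.
Qed.

Lemma nondegenerate_rho (n : posNat) (x : K n) i :
  nondegenerate x -> nondegenerate (act (rho n i) x).
Proof.
move=> x_nd m mn y xy.
have: x = act (mu mn) (act (rho m (n * i - i)) y).
  rewrite -act_rho_mu -xy act_rhoD subnK ?leq_pmull ?posNat_gt0 //.
  by rewrite act_rho0 ?dvdn_mulr.
move=> /x_nd mnE; have e := congr1 (@projT1 _ _) mnE; rewrite /= in e.
by subst m; rewrite xy act_mu_id.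
Qed.

(** Strong induction on the length: a degenerate cycle is pulled back from a strictly shorter
    one. *)
Lemma nondegenerate_root (m : posNat) (x : K m) :
  exists (n : posNat) (nm : n %| m) (y : K n), nondegenerate y /\ x = act (mu nm) y.
Proof.
have [b] := ubnP (m : nat); elim: b => // b IHb in m x * => mb.
have [x_nd|] := pselect (nondegenerate x).
  by exists m, (dvdnn m), x; rewrite act_mu_id.
move=> /existsNP[n /existsNP[nm /existsNP[y /not_implyP[xy ne]]]].
have nm_neq : n <> m :> nat.
  by move=> /posNat_inj e; subst n; apply: ne; rewrite xy act_mu_id.
have nm_lt : n < m by rewrite ltn_neqAle dvdn_leq ?posNat_gt0 // andbT; apply/eqP.
have [l [ln [z [z_nd yz]]]] := IHb n y (leq_trans nm_lt mb).
exists l, (dvdn_trans ln nm), z; split=> //.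
by rewrite xy yz (act_muM _ _ (dvdn_trans ln nm)).
Qed.

(** Being fixed by the rotations by [n] and [i], [x] is fixed by that by their gcd. B descends [x]
    to this length, and non-degeneracy forces the gcd to be [n]. *)
Lemma nondegenerate_free (n : posNat) (x : K n) i : propertyB K ->
  nondegenerate x -> act (rho n i) x = x -> n %| i.
Proof.
move=> KB x_nd xi.
have d_gt0 : 0 < gcdn n i by rewrite gcdn_gt0 posNat_gt0.
have [|y xy] := KB n x (PosNat d_gt0) (dvdn_gcdl n i).
  by apply: act_rho_gcd; rewrite ?posNat_gt0 // act_rho0.
have /(congr1 (fun p => posNat_val (projT1 p))) /= <- := x_nd _ _ _ xy.
exact: dvdn_gcdr.
Qed.

Lemma nondegenerate_root_unique (m n n' : posNat) (nm : n %| m) (nm' : n' %| m)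
    (y : K n) (y' : K n') :
  propertyA K -> propertyB K -> nondegenerate y -> nondegenerate y' ->
  act (mu nm) y = act (mu nm') y' -> existT K n y = existT K n' y'.
Proof.
move=> KA KB y_nd y'_nd yy'.
have d_gt0 : 0 < gcdn n n' by rewrite gcdn_gt0 posNat_gt0.
pose d := PosNat d_gt0.
have dn : d %| n := dvdn_gcdl n n'.
have dn' : d %| n' := dvdn_gcdr n n'.
have dm := dvdn_trans dn nm.
have [|z yz] := KB m (act (mu nm) y) d dm.
  apply: act_rho_gcd; first exact: posNat_gt0.
    by rewrite act_rho_mu act_rho0.
  by rewrite yy' act_rho_mu act_rho0.
(* Property A cancels the projection to [C_n]: the two sides agree once pulled back to [C_m]. *)
have zy : y = act (mu dn) z by apply: (KA _ _ nm); rewrite yz act_muM.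
have zy' : y' = act (mu dn') z by apply: (KA _ _ nm'); rewrite -yy' yz act_muM.
by rewrite -(y_nd _ _ _ zy) -(y'_nd _ _ _ zy').
Qed.

End RotationAction.

(** * Decomposition into representables under A and B *)

Section Decomposition.
Variable K : cycleSet.
Hypotheses (KA : propertyA K) (KB : propertyB K).

Definition orbRepr (k : posNat) (o : orbNd K k) : {x : K k | nondegenerate x} :=
  sval (cid (qclass_surj o)).

Lemma orbReprK (k : posNat) (o : orbNd K k) : qclass _ (orbRepr o) = o.
Proof. by rewrite /orbRepr; case: cid. Qed.

Notation orbCoprod :=
  (coprod (fun k : posNat => coprod (fun _ : orbNd K k => representable k))).

(** By Yoneda, each summand is mapped to [K] by the chosen representative of its orbit. *)
Definition decomp_fun n (p : orbCoprod n) : K n :=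
  act (projT2 (projT2 p)) (sval (orbRepr (projT1 (projT2 p)))).

Lemma decomp_natural m n (phi : digraphMap (dicycle m) (dicycle n))
    (p : orbCoprod n) :
  decomp_fun (act phi p) = act phi (decomp_fun p).
Proof. exact: act_comp. Qed.

Definition decomp : cycleSetMap orbCoprod K := CycleSetMap decomp_natural.

Lemma decomp_surj n (x : K n) : exists p, x = decomp n p.
Proof.
have [k [kn [y [y_nd ->]]]] := nondegenerate_root x.
pose o : orbNd K k := qclass _ (exist _ y y_nd).
have /orbNdP[i /= ->] : qclass _ (orbRepr o) = qclass _ (exist _ y y_nd) :> orbNd K k.
  exact: orbReprK.
exists (existT _ k (existT _ o (compMap (rho k i) (mu kn)))).
by rewrite /= /decomp_fun /= act_comp.
Qed.

(** Both cycles become projections of rotated representatives. Uniqueness of the non-degenerate root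
    gives equal lengths and orbits; freeness then gives equal rotations. *)
Lemma decomp_inj n : injective (decomp n).
Proof.
move=> [k [o phi]] [k' [o' phi']]; rewrite /= /decomp_fun /=.
have kn := cycle_map_dvdn phi; have kn' := cycle_map_dvdn phi'.
rewrite (cycle_mapE phi kn) (cycle_mapE phi' kn').
move: (phi _) (phi' _) => i i' {phi phi'}; rewrite !act_comp => e.
have := nondegenerate_root_unique KA KB
  (nondegenerate_rho (svalP (orbRepr o))) (nondegenerate_rho (svalP (orbRepr o'))) e.
move=> {}e; have kk' := congr1 (@projT1 _ _) e; rewrite /= in kk'; subst k'.
have {}e := existT_inj e.
have oo' : o = o'.
  rewrite -(orbReprK o) -(orbReprK o'); apply/orbNdP.
  apply: (sameOrbit_trans (y := act (rho k (i : 'I_k)) (sval (orbRepr o)))).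
    by exists i.
  by rewrite e; apply: sameOrbit_sym; exists i'.
subst o'; rewrite (Prop_irrelevance kn' kn).
suff -> : i = i' by [].
(* [k - i'] stands for [-i'], so the difference of the two rotations fixes the representative. *)
have : k %| i + (k - i').
  apply: (nondegenerate_free KB (svalP (orbRepr o))).
  by rewrite addnC -act_rhoD e act_rhoD subnK ?act_rho0 // ltnW.
move=> ki; apply: val_inj => /=.
rewrite -(modn_small (ltn_ord i)) -[RHS](modn_small (ltn_ord i')).
apply/eqP; rewrite -(eqn_modDr (k - i')) [i' + _]subnKC ?(ltnW (ltn_ord i')) //.
by rewrite modnn.
Qed.

Lemma propertyAB_decomp : isomorphic K orbCoprod.
Proof.
apply: isomorphic_sym; exists decomp.
by apply: bij_isIso; [exact: decomp_inj | exact: decomp_surj].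
Qed.

End Decomposition.

(** * Attractors satisfy A and B *)

Lemma attractor_propertyA (K : cycleSet) (G : digraph) :
  isomorphic K (attractor G) -> propertyA K.
Proof.
move=> [f [g [fK gK]]] m n nm x y /(congr1 (f m)); rewrite !natural => xy.
have {}xy : compMap (f n x) (mu nm) = compMap (f n y) (mu nm) by [].
(* The projection is surjective on vertices, hence right-cancellable. *)
rewrite -[x]fK -[y]fK; congr (g n _); apply: cycle_map_eq => a.
by rewrite -(mu_cyc nm) -!compMapE xy.
Qed.

Lemma attractor_propertyB (K : cycleSet) (G : digraph) :
  isomorphic K (attractor G) -> propertyB K.
Proof.
move=> [f [g [fK gK]]] n x k kn /(congr1 (f n)); rewrite natural => xk.
have per := cycle_periodic
  (fun i => congr1 (fun u : digraphMap (dicycle n) G => u i) xk).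
pose y (i : dicycle k) := f n x (cyc n (i : 'I_k)).
have y_edge i j : edge i j -> edge (y i) (y j).
  (* Periodicity removes the reduction modulo [k] in the successor, so the wrap-around edge of [C_k]
     is carried to an edge too. *)
  move=> /edge_cyc ->; rewrite /y /= per.
  exact/map_edge/cyc_edge.
exists (g k (DigraphMap y_edge)); rewrite -[x]fK -natural; congr (g n _).
by apply: cycle_map_eq => a; rewrite compMapE mu_cyc /= /y per.
Qed.

(** * Disjoint unions of digraphs and the unit map *)

Section DisjointUnion.
Variables (I : Type) (F : I -> digraph).

Inductive sumE : {i : I & F i} -> {i : I & F i} -> Prop :=
  SumE i (x y : F i) : edge x y -> sumE (existT _ i x) (existT _ i y).

Definition sumDigraph : digraph := Digraph sumE.

Definition sum_inj (i : I) : digraphMap (F i) sumDigraph :=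
  @DigraphMap (F i) sumDigraph (existT _ i) (@SumE i).

Lemma sumE_index (i : I) (x : F i) (v : sumDigraph) :
  edge (sum_inj i x : sumDigraph) v -> exists2 y, v = sum_inj i y & edge x y.
Proof.
case E: _ v / => [j x' y xy]; have ij := congr1 (@projT1 _ _) E.
rewrite /= in ij; subst j; rewrite -(existT_inj E) in xy.
by exists y.
Qed.

Lemma sum_inj_inj (i : I) : injective (sum_inj i).
Proof. by move=> x y; apply: existT_inj. Qed.

(** All vertices of a directed cycle are reached from 0, and no edge leaves its summand. *)
Lemma cycle_map_sum (n : posNat) (f : digraphMap (dicycle n) sumDigraph) :
  exists i (g : digraphMap (dicycle n) (F i)), f = compMap (sum_inj i) g.
Proof.
pose i := projT1 (f (cyc n 0)).
have fi a : exists y, f (cyc n a) = sum_inj i y.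
  elim: a => [|a [y fa]]; first by exists (projT2 (f (cyc n 0))); rewrite [LHS]sigT_eta.
  have := map_edge f (cyc_edge n a); rewrite fa => /sumE_index[z -> _].
  by exists z.
have {}fi v : exists y, f v = sum_inj i y by rewrite -(cyc_val v).
pose g v := sval (cid (fi v)); have fg v : f v = sum_inj i (g v) := svalP (cid (fi v)).
have g_edge u v : edge u v -> edge (g u) (g v).
  move=> /(map_edge f); rewrite !fg => /sumE_index[z /sum_inj_inj -> //].
by exists i, (DigraphMap g_edge); apply: digraphMap_eq.
Qed.

Lemma coprod_attractor :
  isomorphic (coprod (fun i => attractor (F i))) (attractor sumDigraph).
Proof.
pose h n (p : coprod (fun i => attractor (F i)) n) : attractor sumDigraph n :=
  compMap (sum_inj (projT1 p)) (projT2 p).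
have hN m n (phi : digraphMap (dicycle m) (dicycle n)) p :
  h m (act phi p) = act phi (h n p) by exact: compMapA.
exists (CycleSetMap hN); apply: bij_isIso => n /=.
  move=> [i f] [j g] fg.
  (* Directed cycles are non-empty, so the summand can be read off at vertex 0. *)
  have ij := congr1 (fun u : digraphMap _ sumDigraph => projT1 (u (cyc n 0))) fg.
  rewrite /= in ij; subst j; congr existT; apply: digraphMap_eq => v.
  exact: sum_inj_inj (congr1 (fun u : digraphMap _ sumDigraph => u v) fg).
by move=> f; have [i [g ->]] := cycle_map_sum f; exists (existT _ i g).
Qed.

End DisjointUnion.

(** This merges the indices [k] and orbit into one, as the disjoint union of cycles requires. *)
Lemma coprod_coprod (I : Type) (J : I -> Type) (F : forall i, J i -> cycleSet) :
  isomorphic (coprod (fun i => coprod (F i)))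
    (coprod (fun p : {i : I & J i} => F (projT1 p) (projT2 p))).
Proof.
pose FF (p : {i : I & J i}) := F (projT1 p) (projT2 p).
pose f n (x : coprod (fun i => coprod (F i)) n) : coprod FF n :=
  existT (fun p => FF p n) (existT J (projT1 x) (projT1 (projT2 x)))
    (projT2 (projT2 x)).
pose g n (x : coprod FF n) : coprod (fun i => coprod (F i)) n :=
  existT (fun i => coprod (F i) n) (projT1 (projT1 x))
    (existT (fun j => F (projT1 (projT1 x)) j n) (projT2 (projT1 x)) (projT2 x)).
exists (@CycleSetMap (coprod _) (coprod FF) f (fun _ _ _ _ => erefl)).
exists (@CycleSetMap (coprod FF) (coprod _) g (fun _ _ _ _ => erefl)).
by split=> n; [move=> [i [j x]] | move=> [[i j] x]].
Qed.

(* The inverse of the mate [g : |K| -> D] of [K ~ A(D)] is glued from the cycles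
   [e i] of K corresponding to the components of the disjoint union D. *)
Lemma eta_isIso (K : cycleSet) (I : Type) (k : I -> posNat) :
  isomorphic K (attractor (sumDigraph (fun i => dicycle (k i)))) -> isIso (eta K).
Proof.
set D := sumDigraph _ => -[f [f' [fK f'K]]].
have [g [gE _]] := eta_universal f.
pose e i := f' _ (sum_inj (fun i => dicycle (k i)) i : attractor D (k i)).
pose h (v : D) : realization K := coproj (e (projT1 v)) (projT2 v).
have h_edge u v : edge u v -> edge (h u) (h v).
  by case=> i x y xy; apply: map_edge.
pose hM : digraphMap D (realization K) := DigraphMap h_edge.
(* Every cycle of [K] is a pull-back of some [e i], so naturality reduces the claim to the [e i]. *)
have etaE n x : eta K n x = compMap hM (f n x).
  have [i [phi fx]] := cycle_map_sum (f n x).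
  have -> : x = act phi (e i) by rewrite -natural -[x]fK fx.
  rewrite natural [f n _]natural /e f'K.
  exact: digraphMap_eq.
have gh v : g (h v) = v.
  case: v => i v; have := gE _ (e i); rewrite /e f'K => /= gei.
  exact: (congr1 (fun u : digraphMap _ D => u v) gei).
apply: bij_isIso => n.
  (* [f] is [eta K] followed by [attractor_map g], so its injectivity passes to [eta K]. *)
  by move=> x y xy; rewrite -[x]fK -[y]fK -!gE xy.
move=> u; exists (f' n (compMap g u)); rewrite etaE f'K.
apply: digraphMap_eq => v /=.
(* It remains to see that [hM] after [g] fixes every vertex. On the image of [coproj x], [g] gives
   [f m x] and [hM] leads back to [eta K m x]. *)
have [[m [x i]] ->] := qclass_surj (u v).
have := congr1 (fun w : digraphMap _ _ => w i) (gE m x) => /= ->.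
exact: (congr1 (fun w : digraphMap _ _ => w i) (etaE m x)).
Qed.

Theorem theorem1p52 (K : cycleSet) :
  [<-> exists G : digraph, isomorphic K (attractor G);
       isIso (eta K);
       isomorphic K
         (coprod (fun k : posNat => coprod (fun _ : orbNd K k => representable k)));
       propertyA K /\ propertyB K].
Proof.
have AB : (exists G, isomorphic K (attractor G)) -> propertyA K /\ propertyB K.
  by move=> [G KG]; split;
    [exact: attractor_propertyA KG | exact: attractor_propertyB KG].
have flat : isomorphic K
    (coprod (fun k => coprod (fun _ : orbNd K k => representable k))) ->
  isomorphic K (attractor (sumDigraph
    (fun p : {k : posNat & orbNd K k} => dicycle (projT1 p)))).
  move=> Kd; apply: isomorphic_trans Kd _.
  (* [representable k] is convertible to [attractor (dicycle k)]. *)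
  exact: isomorphic_trans (coprod_coprod _) (coprod_attractor _).
have attr : isIso (eta K) -> exists G, isomorphic K (attractor G).
  by move=> eta_iso; exists (realization K), (eta K).
(* The implications are proved cyclically; those into (1), (2) and (3) all pass through A and B. *)
tfae=> [/AB[KA KB] | /attr/AB[KA KB] | Kd | [KA KB]].
- exact: eta_isIso (flat (propertyAB_decomp KA KB)).
- exact: propertyAB_decomp.
- by apply: AB; eexists; exact: flat Kd.
- by eexists; exact: flat (propertyAB_decomp KA KB).
Qed.
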